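(* For all integers $n\ge 0$ and $k\ge 1$, $$\sum_{m=0}^{n}\frac{\binom{n}{m}}{\binom{k+m}{m}}S_2(k+m,k)(-k)^{n-m}=\sum_{m=0}^{n}\widehat{C}_m^{(k)}S_2(n,m).$$
   Context: $(x)_n = x(x-1)\cdots(x-n+1)$ denotes the falling factorial, with $(x)_0=1$. For integers $k\ge1$, $n\ge0$, the Cauchy numbers of the second kind of order $k$ are $$\widehat{C}_n^{(k)}=\int_0^1\cdots\int_0^1 (-(x_1+\cdots+x_k))_n\,dx_1\cdots dx_k.$$ $S_2(l,n)$ are the Stirling numbers of the second kind, defined by $(e^t-1)^n=n!\sum_{l=n}^\infty S_2(l,n)\frac{t^l}{l!}$. *)

(* Defs.v *)
From Stdlib Require Import Reals Lra Lia Arith.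
From Coquelicot Require Import Coquelicot.
Open Scope R_scope.

(** [falling x n] is [x (x - 1) ... (x - n + 1)]. *)
Fixpoint falling (x : R) (n : nat) : R :=
  match n with
  | O => 1
  | S m => falling x m * (x - INR m)
  end.

(** Iterated integral over the unit cube [[0,1]^k], with [R^k] represented by
    Coquelicot's [Tn k R]; the first component is the outermost variable.
    [RInt] is total, with an unspecified value on functions that are not
    Riemann integrable; [cauchy2] only applies it to integrands that are
    polynomial in all variables. *)
Fixpoint cube_int (k : nat) : (Tn k R -> R) -> R :=
  match k return (Tn k R -> R) -> R with
  | O => fun f => f tt
  | S j => fun f => RInt (fun x => cube_int j (fun xs => f (x, xs))) 0 1
  end.

Fixpoint vsum (k : nat) : Tn k R -> R :=
  match k return Tn k R -> R with
  | O => fun _ => 0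
  | S j => fun v => fst v + vsum j (snd v)
  end.

(** Cauchy numbers of the second kind, of order [k]. *)
Definition cauchy2 (k n : nat) : R :=
  cube_int k (fun v => falling (- vsum k v) n).

(** Formal power series are given by their coefficient sequences, and
    [PS_mult] is their Cauchy product. *)
Fixpoint PS_pow (a : nat -> R) (n : nat) : nat -> R :=
  match n with
  | O => fun l => match l with O => 1 | S _ => 0 end
  | S m => PS_mult a (PS_pow a m)
  end.

(** The power series of [e^t - 1]. *)
Definition PS_expm1 (l : nat) : R :=
  match l with
  | O => 0
  | S _ => / INR (fact l)
  end.

(** Stirling numbers of the second kind [S_2(l,n)], obtained by comparing the
    coefficients of [t^l] in
      [(e^t - 1)^n = n! * sum_(l >= n) S_2(l,n) t^l / l!].
    [stirling2_lt] and [stirling2_gf] recover that identity. *)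
Definition stirling2 (l n : nat) : R :=
  INR (fact l) / INR (fact n) * PS_pow PS_expm1 n l.

Lemma PS_pow_expm1_lt (n l : nat) : (l < n)%nat -> PS_pow PS_expm1 n l = 0.
Proof.
revert l; induction n as [|n IH]; intros l Hl; [lia|].
simpl; unfold PS_mult.
transitivity (sum_f_R0 (fun _ => 0) l).
- apply sum_eq; intros [|i] Hi; [simpl; ring|].
  rewrite IH by lia; ring.
- rewrite sum_cte; ring.
Qed.

Lemma stirling2_lt (l n : nat) : (l < n)%nat -> stirling2 l n = 0.
Proof.
intros H; unfold stirling2; rewrite PS_pow_expm1_lt by exact H; ring.
Qed.

Lemma CV_radius_entire (a : nat -> R) :
  (forall x : R, ex_pseries a x) -> CV_radius a = p_infty.
Proof.
intros H.
assert (A : forall x : R, 0 <= x -> Rbar_le x (CV_radius a)).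
{ intros x Hx; apply Rbar_not_lt_le; intros Hlt.
  rewrite <- (Rabs_pos_eq x) in Hlt by exact Hx.
  apply (CV_disk_outside a x Hlt).
  apply ex_series_lim_0.
  apply (ex_series_ext (fun k => scal (pow_n x k) (a k))); [|apply H].
  intros i; rewrite pow_n_pow; apply Rmult_comm. }
destruct (CV_radius a) as [r| |]; [|reflexivity|].
- assert (B : 0 <= Rabs r + 1) by (assert (C := Rabs_pos r); lra).
  apply A in B; simpl in B; assert (C := Rle_abs r); lra.
- destruct (A 0 (Rle_refl 0)).
Qed.

Lemma is_series_zero : is_series (fun _ : nat => 0) 0.
Proof.
apply (filterlim_ext (fun _ : nat => 0)).
- intros n; symmetry; rewrite sum_n_const; ring.
- apply filterlim_const.
Qed.

Lemma is_pseries_expm1 (t : R) : is_pseries PS_expm1 t (exp t - 1).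
Proof.
assert (H : is_pseries (fun n => / INR (fact n)) t (exp t))
  by apply is_exp_Reals.
unfold is_pseries in *.
apply is_series_decr_1.
apply (is_series_ext
  (fun j => scal (pow_n t (S j)) (/ INR (fact (S j))))); [reflexivity|].
apply (is_series_incr_1 (fun j => scal (pow_n t j) (/ INR (fact j)))).
match goal with |- is_series _ ?l => replace l with (exp t) end;
  [exact H|].
unfold plus, opp, scal; simpl; unfold mult, one; simpl.
rewrite Rinv_1; ring.
Qed.

Lemma is_pseries_pow_expm1 (n : nat) (t : R) :
  is_pseries (PS_pow PS_expm1 n) t ((exp t - 1) ^ n).
Proof.
revert t; induction n as [|n IH]; intros t.
- unfold is_pseries; apply is_series_decr_1.
  apply (is_series_ext (fun _ => 0)).
  + intros j; simpl; unfold scal; simpl; unfold mult; simpl; ring.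
  + match goal with |- is_series _ ?l => replace l with 0 end;
      [exact is_series_zero|].
    unfold plus, opp, scal; simpl; unfold mult, one; simpl; ring.
- simpl; apply is_pseries_mult.
  + apply is_pseries_expm1.
  + apply IH.
  + rewrite CV_radius_entire; [exact I|].
    intros x; exists (exp x - 1); apply is_pseries_expm1.
  + rewrite CV_radius_entire; [exact I|].
    intros x; exists ((exp x - 1) ^ n); apply IH.
Qed.

Lemma stirling2_gf (n : nat) (t : R) :
  is_series
    (fun j => INR (fact n) *
       (stirling2 (n + j) n * t ^ (n + j) / INR (fact (n + j))))
    ((exp t - 1) ^ n).
Proof.
assert (H := is_pseries_pow_expm1 n t); unfold is_pseries in H.
apply (is_series_ext
  (fun j => scal (pow_n t (n + j)) (PS_pow PS_expm1 n (n + j)))).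
{ intros j; rewrite pow_n_pow; unfold stirling2, scal; simpl;
  unfold mult; simpl; field; split; apply INR_fact_neq_0. }
destruct n as [|n]; [exact H|].
apply (is_series_incr_n
  (fun j => scal (pow_n t j) (PS_pow PS_expm1 (S n) j))); [lia|].
match goal with |- is_series _ ?l => replace l with ((exp t - 1) ^ S n) end;
  [exact H|].
rewrite (sum_n_ext_loc _ (fun _ => 0)).
- rewrite sum_n_const; unfold plus; simpl; ring.
- intros j Hj; rewrite PS_pow_expm1_lt by (simpl in Hj; lia).
  unfold scal; simpl; unfold mult; simpl; ring.
Qed.

(* Main.v *)
Require Import Defs.
From Stdlib Require Import Reals Lia Factorial.
From Coquelicot Require Import Coquelicot.
Open Scope R_scope.

(** Let [S = x_1 + ... + x_k] with the [x_i] independent and uniform on [[0,1]],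
    and let [E] be the expectation, that is, the integral over the cube.  Both
    sides of the identity are equal to [E ((- S) ^ n)].

    On the right, [cauchy2 k m] is [E] of the falling factorial of [- S], so
    the connection formula [x ^ n = sum_m S_2(n,m) (x)_m]
    ([pow_stirling2_falling]) and the linearity of [E] give [E ((- S) ^ n)].

    On the left, [E (S ^ m)] is the coefficient of [t ^ m / m!] in
    [E (exp (t S)) = ((exp t - 1) / t) ^ k], which is
    [S_2(k+m,k) / binom(k+m,m)] ([moment_PS_pow], [moment_stirling2]).  The
    left-hand side is therefore the binomial expansion of [E ((S - k) ^ n)].
    The reflections [x_i -> 1 - x_i] preserve the cube and exchange [S - k] and
    [- S], so this is again [E ((- S) ^ n)] ([iter_window_reflect]).

    Since every integrand depends on [S] alone, the cube integral is the
    [k]-fold iterate of the one-variable operator [window], which sends [f] to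
    [y |-> int_y^(y+1) f] ([cube_int_vsum]); all the analysis is done with this
    operator on continuous functions. *)

(** * Stirling numbers and falling factorials *)

(** Coefficientwise form of the differential equation
    [((exp t - 1) ^ (m+1))' = (m+1) ((exp t - 1) ^ (m+1) + (exp t - 1) ^ m)].
    The two sides are entire functions of [t], so their coefficients agree. *)
Lemma PS_pow_expm1_S (m l : nat) :
  INR (S l) * PS_pow PS_expm1 (S m) (S l)
  = INR (S m) * (PS_pow PS_expm1 (S m) l + PS_pow PS_expm1 m l).
Proof.
assert (Rad : forall n, CV_radius (PS_pow PS_expm1 n) = p_infty).
{ intros n; apply CV_radius_entire; intros x.
  exists ((exp x - 1) ^ n); apply is_pseries_pow_expm1. }
assert (L : forall t, is_pseries (PS_derive (PS_pow PS_expm1 (S m))) t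
                        (INR (S m) * exp t * (exp t - 1) ^ m)).
{ intros t.
  assert (D : Derive (PSeries (PS_pow PS_expm1 (S m))) t
              = INR (S m) * exp t * (exp t - 1) ^ m).
  { rewrite (Derive_ext _ (fun t => (exp t - 1) ^ S m)).
    - apply is_derive_unique; auto_derive; [trivial|].
      change (@eq R (1 * exp t * (INR (S m) * (exp t - 1) ^ m))
                (INR (S m) * exp t * (exp t - 1) ^ m)); ring.
    - intros x; apply is_pseries_unique, is_pseries_pow_expm1. }
  rewrite <- D; apply is_pseries_derive; rewrite Rad; exact I. }
set (b := PS_scal (INR (S m))
            (PS_plus (PS_pow PS_expm1 (S m)) (PS_pow PS_expm1 m))).
assert (B : forall t, is_pseries b t (INR (S m) * exp t * (exp t - 1) ^ m)).
{ intros t.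
  replace (INR (S m) * exp t * (exp t - 1) ^ m)
    with (scal (INR (S m)) (plus ((exp t - 1) ^ S m) ((exp t - 1) ^ m))).
  - apply (@is_pseries_scal R_AbsRing R_NormedModule); [apply Rmult_comm|].
    apply (@is_pseries_plus R_AbsRing R_NormedModule); apply is_pseries_pow_expm1.
  - unfold scal, plus; simpl; unfold mult; simpl; ring. }
change (PS_derive (PS_pow PS_expm1 (S m)) l = b l).
apply PSeries_ext_recip.
- rewrite CV_radius_derive, Rad; exact I.
- rewrite CV_radius_entire; [exact I|intros x; eexists; apply B].
- apply filter_forall; intros t.
  now rewrite (is_pseries_unique _ _ _ (L t)), (is_pseries_unique _ _ _ (B t)).
Qed.

Lemma stirling2_0_0 : stirling2 0 0 = 1.
Proof. unfold stirling2; simpl; field. Qed.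

Lemma stirling2_S_0 (n : nat) : stirling2 (S n) 0 = 0.
Proof. unfold stirling2; simpl PS_pow; ring. Qed.

Lemma stirling2_S_S (n m : nat) :
  stirling2 (S n) (S m) = INR (S m) * stirling2 n (S m) + stirling2 n m.
Proof.
unfold stirling2.
assert (H := PS_pow_expm1_S m n).
set (p := PS_pow PS_expm1 (S m) (S n)) in *.
rewrite !fact_simpl, !mult_INR.
assert (F := INR_fact_neq_0 m).
assert (N : INR (S m) <> 0) by (apply not_0_INR; lia).
replace (INR (S n) * INR (fact n) / (INR (S m) * INR (fact m)) * p)
  with (INR (fact n) / (INR (S m) * INR (fact m)) * (INR (S n) * p))
  by (field; split; assumption).
rewrite H; field; split; assumption.
Qed.

Lemma sum_f_R0_shift (g : nat -> R) (n : nat) :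
  sum_f_R0 (fun m => g (S m)) n = sum_f_R0 g n + g (S n) - g O.
Proof.
induction n as [|n IH]; simpl; [ring|].
rewrite IH; simpl; ring.
Qed.

Lemma pow_stirling2_falling (x : R) (n : nat) :
  x ^ n = sum_f_R0 (fun m => stirling2 n m * falling x m) n.
Proof.
induction n as [|n IH].
- simpl; rewrite stirling2_0_0; ring.
- rewrite decomp_sum by lia; simpl pred.
  rewrite stirling2_S_0, Rmult_0_l, Rplus_0_l.
  rewrite (sum_eq _ (fun m => INR (S m) * stirling2 n (S m) * falling x (S m)
                              + stirling2 n m * falling x (S m)))
    by (intros m _; rewrite stirling2_S_S; ring).
  rewrite plus_sum.
  rewrite (sum_f_R0_shift (fun m => INR m * stirling2 n m * falling x m)).
  rewrite (stirling2_lt n (S n)) by lia.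
  change (x ^ S n) with (x * x ^ n); rewrite IH, scal_sum.
  rewrite (sum_eq _ (fun m => INR m * stirling2 n m * falling x m
                              + stirling2 n m * falling x (S m)))
    by (intros m _; simpl falling; ring).
  rewrite plus_sum; simpl INR; ring.
Qed.

(** * Integration over a sliding unit window *)

(** Convolution with the uniform law on [[-1,0]]: this is the expectation of
    [f (y + x)] for [x] uniform on [[0,1]]. *)
Definition window (f : R -> R) (y : R) : R := RInt f y (y + 1).

Definition iter_window (k : nat) (f : R -> R) : R -> R := Nat.iter k window f.

Lemma ex_RInt_cont (f : R -> R) (a b : R) :
  (forall x, continuous f x) -> ex_RInt f a b.
Proof. intros Hf; apply @ex_RInt_continuous; intros z _; apply Hf. Qed.

(** [window f] is the difference [F (y + 1) - F y] of values of a primitive [F]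
    of [f], hence differentiable. *)
Lemma window_continuous (f : R -> R) :
  (forall x, continuous f x) -> forall y, continuous (window f) y.
Proof.
intros Hf y.
assert (D : forall x, is_derive (RInt f 0) x (f x)).
{ intros x; apply (is_derive_RInt f (RInt f 0) 0); [|apply Hf].
  apply filter_forall; intros z.
  apply @RInt_correct, ex_RInt_cont, Hf. }
apply (continuous_ext (fun y => minus (RInt f 0 (y + 1)) (RInt f 0 y))).
{ intros z; unfold window, minus.
  rewrite <- (RInt_Chasles f 0 z (z + 1)) by (apply ex_RInt_cont, Hf).
  unfold plus, opp; simpl; ring. }
apply @continuous_minus.
- apply (continuous_comp (fun y => y + 1) (RInt f 0)).
  + apply @continuous_plus; [apply continuous_id|apply continuous_const].
  + apply @ex_derive_continuous; eexists; apply D.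
- apply @ex_derive_continuous; eexists; apply D.
Qed.

Lemma iter_window_continuous (k : nat) (f : R -> R) :
  (forall x, continuous f x) -> forall y, continuous (iter_window k f) y.
Proof.
intros Hf; induction k as [|k IH]; [exact Hf|].
apply window_continuous, IH.
Qed.

Lemma window_ext (f g : R -> R) :
  (forall x, f x = g x) -> forall y, window f y = window g y.
Proof. intros H y; apply RInt_ext; intros; apply H. Qed.

Lemma iter_window_ext (k : nat) (f g : R -> R) :
  (forall x, f x = g x) -> forall y, iter_window k f y = iter_window k g y.
Proof.
intros H; induction k as [|k IH]; [exact H|].
apply window_ext, IH.
Qed.

Lemma iter_window_S_r (k : nat) (f : R -> R) :
  iter_window (S k) f = iter_window k (window f).
Proof. apply Nat.iter_succ_r. Qed.

Lemma iter_window_plus (k : nat) (f g : R -> R) :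
  (forall x, continuous f x) -> (forall x, continuous g x) ->
  forall y, iter_window k (fun x => f x + g x) y
            = iter_window k f y + iter_window k g y.
Proof.
intros Hf Hg; induction k as [|k IH]; intros y; [reflexivity|].
change (window (iter_window k (fun x => f x + g x)) y
        = window (iter_window k f) y + window (iter_window k g) y).
rewrite (window_ext _ _ IH).
apply @RInt_plus; apply ex_RInt_cont; apply iter_window_continuous; assumption.
Qed.

Lemma iter_window_scal (k : nat) (c : R) (f : R -> R) :
  (forall x, continuous f x) ->
  forall y, iter_window k (fun x => c * f x) y = c * iter_window k f y.
Proof.
intros Hf; induction k as [|k IH]; intros y; [reflexivity|].
change (window (iter_window k (fun x => c * f x)) y
        = c * window (iter_window k f) y).
rewrite (window_ext _ _ IH).
apply @RInt_scal, ex_RInt_cont, iter_window_continuous, Hf.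
Qed.

Lemma continuous_sum_f_R0 (F : nat -> R -> R) (n : nat) :
  (forall m x, continuous (F m) x) ->
  forall x, continuous (fun x => sum_f_R0 (fun m => F m x) n) x.
Proof.
intros HF; induction n as [|n IH]; intros x; [apply HF|].
apply @continuous_plus; [apply IH|apply HF].
Qed.

Lemma continuous_cmult (c : R) (f : R -> R) :
  (forall x, continuous f x) -> forall x, continuous (fun x => c * f x) x.
Proof.
intros Hf x; apply (continuous_mult (fun _ => c) f);
  [apply continuous_const|apply Hf].
Qed.

Lemma iter_window_lin_comb (k : nat) (c : nat -> R) (F : nat -> R -> R) (n : nat) :
  (forall m x, continuous (F m) x) ->
  forall y, iter_window k (fun x => sum_f_R0 (fun m => c m * F m x) n) y
            = sum_f_R0 (fun m => c m * iter_window k (F m) y) n.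
Proof.
intros HF y; induction n as [|n IH].
- apply iter_window_scal, HF.
- simpl sum_f_R0; rewrite <- IH, <- iter_window_scal by apply HF.
  apply iter_window_plus.
  + apply (continuous_sum_f_R0 (fun m x => c m * F m x)).
    intros m; apply continuous_cmult, HF.
  + apply continuous_cmult, HF.
Qed.

(** Change of variables [x_i -> 1 - x_i]: each of the [k] integrations turns the
    window [[y, y+1]] around and so moves its left end by one. *)
Lemma iter_window_reflect (k : nat) (c : R) (f : R -> R) :
  (forall x, continuous f x) ->
  forall y, iter_window k (fun x => f (c - x)) y
            = iter_window k f (c - INR k - y).
Proof.
intros Hf; induction k as [|k IH]; intros y.
- simpl; f_equal; ring.
- change (window (iter_window k (fun x => f (c - x))) y
          = window (iter_window k f) (c - INR (S k) - y)).
  rewrite (window_ext _ _ IH); unfold window.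
  set (h := iter_window k f); rewrite S_INR.
  assert (E : forall a b, ex_RInt h a b)
    by (intros a b; apply ex_RInt_cont, iter_window_continuous, Hf).
  rewrite <- (opp_RInt_swap h) by apply E.
  replace (c - (INR k + 1) - y + 1) with (-1 * y + (c - INR k)) by ring.
  replace (c - (INR k + 1) - y) with (-1 * (y + 1) + (c - INR k)) by ring.
  rewrite <- (RInt_comp_lin h) by apply E.
  rewrite (RInt_ext (fun x => scal (-1) (h (-1 * x + (c - INR k))))
             (fun x => opp (h (c - INR k - x)))).
  + rewrite (RInt_opp (fun x => h (c - INR k - x))).
    * symmetry; apply @opp_opp.
    * apply ex_RInt_cont; intros x.
      apply (continuous_comp (fun x => c - INR k - x) h).
      -- apply @continuous_minus; [apply continuous_const|apply continuous_id].
      -- apply iter_window_continuous, Hf.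
  + intros x _; unfold scal, opp; simpl; unfold mult; simpl.
    replace (-1 * x + (c - INR k)) with (c - INR k - x) by ring; ring.
Qed.

Lemma cube_int_ext (k : nat) (f g : Tn k R -> R) :
  (forall v, f v = g v) -> cube_int k f = cube_int k g.
Proof.
induction k as [|k IH]; intros H; [apply H|].
apply RInt_ext; intros x _; apply IH; intros v; apply H.
Qed.

(** The offset [y] accumulates the outer variables in the induction. *)
Lemma cube_int_vsum (k : nat) (f : R -> R) :
  (forall x, continuous f x) ->
  forall y, cube_int k (fun v => f (y + vsum k v)) = iter_window k f y.
Proof.
intros Hf; induction k as [|k IH]; intros y.
- simpl; f_equal; ring.
- change (RInt (fun x => cube_int k (fun xs => f (y + (x + vsum k xs)))) 0 1
          = RInt (iter_window k f) y (y + 1)).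
  assert (H := RInt_comp_lin (iter_window k f) 1 y 0 1).
  replace (1 * 0 + y) with y in H by ring.
  replace (1 * 1 + y) with (y + 1) in H by ring.
  rewrite <- H by apply ex_RInt_cont, iter_window_continuous, Hf.
  apply RInt_ext; intros x _.
  rewrite <- IH; unfold scal; simpl; unfold mult; simpl.
  rewrite Rmult_1_l; apply cube_int_ext; intros v; f_equal; ring.
Qed.

(** * Moments of the sum of the coordinates *)

Lemma continuous_pow (m : nat) (x : R) : continuous (fun x => x ^ m) x.
Proof. apply @ex_derive_continuous; auto_derive; trivial. Qed.

(** The integral is [((y + 1) ^ (m+1) - y ^ (m+1)) / (m+1)], and the subtracted
    term cancels the top term of the binomial expansion. *)
Lemma window_pow (m : nat) (y : R) :
  window (fun x => x ^ m) y
  = sum_f_R0 (fun i => Binomial.C (S m) i / INR (S m) * y ^ i) m.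
Proof.
assert (N : INR (S m) <> 0) by (apply not_0_INR; lia).
assert (I : is_RInt (fun x => x ^ m) y (y + 1)
              (minus ((y + 1) ^ S m / INR (S m)) (y ^ S m / INR (S m)))).
{ apply (is_RInt_derive (fun x => x ^ S m / INR (S m))).
  - intros x _; auto_derive; [trivial|].
    change (pred (S m)) with m; field; exact N.
  - intros x _; apply continuous_pow. }
unfold window; rewrite (is_RInt_unique _ _ _ _ I).
rewrite binomial; simpl sum_f_R0.
rewrite Nat.sub_diag, C_n_n; unfold minus, plus, opp; simpl plus.
rewrite (sum_eq (fun i => Binomial.C (S m) i / INR (S m) * y ^ i)
  (fun i => Binomial.C (S m) i * y ^ i * 1 ^ (S m - i) * / INR (S m))).
- rewrite <- scal_sum.
  change (Hierarchy.opp (y ^ S m / INR (S m))) with (- (y ^ S m / INR (S m))).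
  simpl; field; exact N.
- intros i _; rewrite pow1; field; exact N.
Qed.

Lemma sum_f_R0_drop (g : nat -> R) (k n : nat) :
  (forall i, (i < k)%nat -> g i = 0) ->
  sum_f_R0 g (k + n) = sum_f_R0 (fun i => g (k + i)%nat) n.
Proof.
intros H; induction n as [|n IH].
- rewrite Nat.add_0_r; simpl; rewrite Nat.add_0_r.
  destruct k as [|k]; [reflexivity|]; simpl.
  rewrite (sum_eq _ (fun _ => 0)) by (intros i Hi; apply H; lia).
  rewrite sum_cte; ring.
- rewrite Nat.add_succ_r; simpl; rewrite IH, Nat.add_succ_r; reflexivity.
Qed.

Lemma PS_pow_expm1_S_conv (k m : nat) :
  PS_pow PS_expm1 (S k) (S k + m)
  = sum_f_R0 (fun i => PS_pow PS_expm1 k (k + i) / INR (fact (S m - i))) m.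
Proof.
replace (S k + m)%nat with (k + S m)%nat by lia.
simpl PS_pow; unfold PS_mult.
rewrite <- (sum_f_R0_skip
  (fun i => PS_expm1 i * PS_pow PS_expm1 k (k + S m - i))).
rewrite (sum_f_R0_drop (fun i => PS_expm1 (k + S m - i)
  * PS_pow PS_expm1 k (k + S m - (k + S m - i)))).
- rewrite tech5.
  replace (k + S m - (k + S m))%nat with O by lia; change (PS_expm1 0) with 0.
  rewrite Rmult_0_l, Rplus_0_r; apply sum_eq; intros i Hi.
  replace (k + S m - (k + S m - (k + i)))%nat with (k + i)%nat by lia.
  replace (k + S m - (k + i))%nat with (S (m - i)) by lia.
  replace (S m - i)%nat with (S (m - i)) by lia; apply Rmult_comm.
- intros i Hi; rewrite PS_pow_expm1_lt by lia; ring.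
Qed.

(** [E (S ^ m) / m!] is the coefficient of [t ^ (k+m)] in [(exp t - 1) ^ k]: by
    [window_pow], integrating out one more variable is the Cauchy product with
    [(exp t - 1) / t]. *)
Lemma moment_PS_pow (k m : nat) :
  iter_window k (fun x => x ^ m) 0
  = INR (fact m) * PS_pow PS_expm1 k (k + m).
Proof.
revert m; induction k as [|k IH]; intros m.
- destruct m as [|m]; simpl; ring.
- rewrite iter_window_S_r, (iter_window_ext _ _ _ (window_pow m)).
  rewrite (iter_window_lin_comb k (fun i => Binomial.C (S m) i / INR (S m))
             (fun i x => x ^ i)) by (intros; apply continuous_pow).
  rewrite PS_pow_expm1_S_conv, scal_sum; apply sum_eq; intros i Hi.
  rewrite IH; unfold Binomial.C.
  rewrite (fact_simpl m), mult_INR.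
  field; repeat split; try apply INR_fact_neq_0; apply not_0_INR; lia.
Qed.

Lemma moment_stirling2 (k m : nat) :
  iter_window k (fun x => x ^ m) 0
  = stirling2 (k + m) k / Binomial.C (k + m) m.
Proof.
rewrite moment_PS_pow; unfold stirling2, Binomial.C.
replace (k + m - m)%nat with k by lia.
field; repeat split; apply INR_fact_neq_0.
Qed.

(** * The two evaluations of the moment of [- S] *)

Lemma continuous_falling_opp (m : nat) (x : R) :
  continuous (fun x => falling (- x) m) x.
Proof.
revert x; induction m as [|m IH]; intros x; [apply continuous_const|].
apply (continuous_mult (fun x => falling (- x) m) (fun x => - x - INR m));
  [apply IH|].
apply @ex_derive_continuous; auto_derive; trivial.
Qed.

Lemma cauchy2_window (k m : nat) :
  cauchy2 k m = iter_window k (fun x => falling (- x) m) 0.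
Proof.
rewrite <- cube_int_vsum by apply continuous_falling_opp.
apply cube_int_ext; intros v; rewrite Rplus_0_l; reflexivity.
Qed.

Theorem theorem2p6 (n k : nat) (hk : (1 <= k)%nat) :
  sum_f_R0 (fun m =>
    Binomial.C n m / Binomial.C (k + m) m * stirling2 (k + m) k
      * (- INR k) ^ (n - m)) n
  = sum_f_R0 (fun m => cauchy2 k m * stirling2 n m) n.
Proof.
transitivity (iter_window k (fun x => (- x) ^ n) 0).
- (* reflection about [k / 2], the centre of symmetry of the law of [S] *)
  rewrite (iter_window_ext k (fun x => (- x) ^ n)
             (fun x => (INR k - x + - INR k) ^ n)) by (intros x; f_equal; ring).
  rewrite (iter_window_reflect k (INR k) (fun x => (x + - INR k) ^ n))
    by (intros x; apply @ex_derive_continuous; auto_derive; trivial).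
  replace (INR k - INR k - 0) with 0 by ring.
  rewrite (iter_window_ext k (fun x => (x + - INR k) ^ n)
    (fun x => sum_f_R0
       (fun m => Binomial.C n m * (- INR k) ^ (n - m) * x ^ m) n))
    by (intros x; rewrite binomial; apply sum_eq; intros; ring).
  rewrite (iter_window_lin_comb k
    (fun m => Binomial.C n m * (- INR k) ^ (n - m)) (fun m x => x ^ m))
    by (intros; apply continuous_pow).
  apply sum_eq; intros m _; rewrite moment_stirling2; unfold Rdiv; ring.
- rewrite (iter_window_ext _ _ _ (fun x => pow_stirling2_falling (- x) n)).
  rewrite (iter_window_lin_comb k (stirling2 n) (fun m x => falling (- x) m))
    by (intros; apply continuous_falling_opp).
  apply sum_eq; intros m _; rewrite cauchy2_window; ring.
Qed.
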